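(* Let $2\le n\le\infty$ and let $\omega$ be a state on $\mathcal{O}_n$. If there exists an isometry $u$ in $\mathcal{O}_n^+$ (that is, $u^*u=I$) such that $\omega(u)=1$, then $\omega$ is minimal.
   Context: For $2\le n\le\infty$, $\mathcal{O}_n$ is the Cuntz algebra with Cuntz generators $s_1,\ldots,s_n$ (a sequence $s_1,s_2,\ldots$ if $n=\infty$): the universal unital C*-algebra generated by elements with $s_i^*s_j=\delta_{ij}I$ and $\sum_{i=1}^n s_is_i^*=I$ if $n<\infty$, respectively $\sum_{i=1}^k s_is_i^*\le I$ for all $k\geq 1$ if $n=\infty$. When $n=\infty$, $\{1,\ldots,n\}$ means $\{1,2,\ldots\}$. Let $\mathcal{I}_n=\bigcup_{l\ge0}\{1,\ldots,n\}^l$ be the set of finite words, $\{1,\ldots,n\}^0=\{\emptyset\}$, $s_J=s_{j_1}\cdots s_{j_l}$ for $J=(j_1,\ldots,j_l)$, $s_\emptyset=I$. $\mathcal{O}_n^+$ denotes the norm-closed linear span of $\{s_J: J\in\mathcal{I}_n, J\ne\emptyset\}$ in $\mathcal{O}_n$. For states $\omega,\omega'$ on $\mathcal{O}_n$, write $\omega\sim\omega'$ if their GNS representations are unitarily equivalent. For a state $\omega$ with GNS representation $(\mathcal{H},\pi,\Omega)$, let $\mathcal{K}(\omega)$ be the closed linear span of $\{\pi(s_J)^*\Omega: J\in\mathcal{I}_n\}$ in $\mathcal{H}$, $\mathrm{c}\dim\omega:=\dim\mathcal{K}(\omega)\in\{1,2,\ldots,\infty\}$ (Hilbert space dimension), and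 $\kappa(\omega):=\min\{\mathrm{c}\dim\omega':\omega'\text{ a state on }\mathcal{O}_n,\ \omega'\sim\omega\}$. A state $\omega$ is minimal if $\mathrm{c}\dim\omega=\kappa(\omega)$. *)

(* Defs.v *)
From HB Require Import structures.
From mathcomp Require Import all_boot all_order all_algebra.
From mathcomp Require Import all_classical all_reals all_analysis.
From mathcomp.real_closed Require Export complex.
Export numFieldNormedType.Exports.

Set Implicit Arguments.
Unset Strict Implicit.
Unset Printing Implicit Defensive.

Import Order.TTheory GRing.Theory Num.Theory.

Local Open Scope classical_set_scope.
Local Open Scope ring_scope.

(* Unital C*-algebras. The norm of a normed module over R[i] takes its values in
   R[i]; they are real and nonnegative. The multiplication is part of this mixin
   because no structure can join the ring and normed module hierarchies: the
   library already joins them in numDomainType only. *)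
HB.mixin Record isCStarAlgebra (R : realType) (A : Type)
    of CompleteNormedModule R[i] A := {
  cone : A;
  cmul : A -> A -> A;
  star : A -> A;
  cmulA : forall a b c : A, cmul a (cmul b c) = cmul (cmul a b) c;
  cmul1l : forall a : A, cmul cone a = a;
  cmul1r : forall a : A, cmul a cone = a;
  cmulDl : forall a b c : A, cmul (a + b) c = cmul a c + cmul b c;
  cmulDr : forall a b c : A, cmul a (b + c) = cmul a b + cmul a c;
  cmulZl : forall (k : R[i]) (a b : A), cmul (k *: a) b = k *: cmul a b;
  cmulZr : forall (k : R[i]) (a b : A), cmul a (k *: b) = k *: cmul a b;
  starD : forall a b : A, star (a + b) = star a + star b;
  starZ : forall (k : R[i]) (a : A), star (k *: a) = k^* *: star a;
  starM : forall a b : A, star (cmul a b) = cmul (star b) (star a);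
  starK : forall a : A, star (star a) = a;
  cmul_norm : forall a b : A, `|cmul a b| <= `|a| * `|b|;
  cstar_norm : forall a : A, `|cmul (star a) a| = `|a| ^+ 2
}.

#[short(type="cstarAlgType")]
HB.structure Definition CStarAlgebra (R : realType) :=
  { A of isCStarAlgebra R A & CompleteNormedModule R[i] A }.

Declare Scope cstar_scope.
Delimit Scope cstar_scope with cstar.
Notation "a ** b" := (cmul a b) (at level 40, left associativity) : cstar_scope.
Notation "\1" := cone (at level 0) : cstar_scope.
Local Open Scope cstar_scope.

(* [hdot] is linear in its first argument and conjugate-linear in the second. *)
HB.mixin Record isHilbert (R : realType) (H : Type)
    of CompleteNormedModule R[i] H := {
  hdot : {dot H for (@Num.conj R[i])};
  hdot_norm : forall x : H, hdot x x = `|x| ^+ 2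
}.

#[short(type="hilbertType")]
HB.structure Definition Hilbert (R : realType) :=
  { H of isHilbert R H & CompleteNormedModule R[i] H }.

Section LinearSpan.
Context {K : numFieldType} {V : normedModType K}.

Definition lspan (S : set V) : set V :=
  [set v | exists (m : nat) (c : 'I_m -> K) (x : 'I_m -> V),
     (forall i, S (x i)) /\ v = \sum_(i < m) c i *: x i].

Definition clspan (S : set V) : set V := closure (lspan S).

End LinearSpan.

Section HilbertDimension.
Context {R : realType} {H : hilbertType R}.

Definition orthonormal_set (E : set H) : Prop :=
  forall x y : H, E x -> E y -> hdot x y = (x == y)%:R.

Definition orthonormal_basis (K E : set H) : Prop :=
  orthonormal_set E /\ clspan E = K.

(* Hilbert space dimension of the closed subspace K, with every infinite
   cardinal sent to +oo. *)
Definition hdim (K : set H) : \bar R :=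
  xget 0%E [set d | exists E : set H, orthonormal_basis K E /\
    ((exists2 m : nat, (E #= `I_m)%card & d = m%:R%:E) \/
     (infinite_set E /\ d = +oo%E))].

End HilbertDimension.

Section Cuntz.
Context {R : realType}.

(* The number n of generators lies in {2, 3, ...} + {oo}, with None for oo. *)
Definition ngen := option nat.

Definition ge2 (n : ngen) : Prop := if n is Some m then (2 <= m)%N else True.

Definition letter (n : ngen) : choiceType := if n is Some m then 'I_m else nat.

Definition word (n : ngen) := seq (letter n).

Definition wordprod (n : ngen) (A : cstarAlgType R) (s : letter n -> A)
  (J : word n) : A := foldr (fun j a => s j ** a) \1 J.

Definition cstar_le (A : cstarAlgType R) (a b : A) : Prop :=
  exists c : A, b - a = star c ** c.

Definition cuntz_sum (n : ngen) (A : cstarAlgType R) :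
    (letter n -> A) -> Prop :=
  match n return (letter n -> A) -> Prop with
  | Some m => fun s : 'I_m -> A => \sum_(i < m) s i ** star (s i) = \1
  | None => fun s : nat -> A => forall k : nat,
      (1 <= k)%N -> cstar_le (\sum_(0 <= i < k) s i ** star (s i)) \1
  end.

Definition cuntz_relations (n : ngen) (A : cstarAlgType R)
    (s : letter n -> A) : Prop :=
  (forall i j : letter n, star (s i) ** s j = (i == j)%:R *: \1) /\ cuntz_sum s.

Definition cstar_subalgebra (A : cstarAlgType R) (S : set A) : Prop :=
  [/\ closed S, S \1, (forall a b, S a -> S b -> S (a + b)),
      (forall a b, S a -> S b -> S (a ** b)) &
      (forall (c : R[i]) a, S a -> S (c *: a)) /\
      (forall a, S a -> S (star a))].

(* (A, s) is the Cuntz algebra O_n with its generators, which is determined up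
   to a unique isomorphism by this property. *)
Definition is_cuntz_algebra (n : ngen) (A : cstarAlgType R)
    (s : letter n -> A) : Prop :=
  [/\ cuntz_relations s,
      (forall S : set A, cstar_subalgebra S -> (forall i, S (s i)) ->
         S = setT) &
      (forall (B : cstarAlgType R) (t : letter n -> B), cuntz_relations t ->
         exists phi : {linear A -> B},
           [/\ phi \1 = \1, (forall a b, phi (a ** b) = phi a ** phi b),
               (forall a, phi (star a) = star (phi a)) &
               (forall i, phi (s i) = t i)])].

Definition cuntz_plus (n : ngen) (A : cstarAlgType R) (s : letter n -> A) :
    set A :=
  clspan [set a | exists2 J : word n, J != [::] & a = wordprod s J].

Section States.
Context {A : cstarAlgType R}.

(* Positive linear functionals of norm one: on a unital C*-algebra the norm of a
   positive functional is attained at 1. *)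
Record state := State {
  state_fun :> {scalar A};
  state_pos : forall a : A, 0 <= state_fun (star a ** a);
  state_norm : forall a : A, `|state_fun a| <= `|a|;
  state1 : state_fun \1 = 1
}.

Record representation (H : hilbertType R) := Representation {
  rep :> A -> {linear H -> H};
  rep_continuous : forall a : A, continuous (rep a);
  repD : forall (a b : A) (x : H), rep (a + b) x = rep a x + rep b x;
  repZ : forall (c : R[i]) (a : A) (x : H), rep (c *: a) x = c *: rep a x;
  repM : forall (a b : A) (x : H), rep (a ** b) x = rep a (rep b x);
  rep1 : forall x : H, rep \1 x = x;
  rep_star : forall (a : A) (x y : H),
    hdot (rep (star a) x) y = hdot x (rep a y)
}.

(* A GNS triple of w; any two of them are unitarily equivalent. *)
Record gns (w : state) := GNS {
  gns_space : hilbertType R;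
  gns_rep : representation gns_space;
  gns_vec : gns_space;
  gns_state : forall a : A, w a = hdot (gns_rep a gns_vec) gns_vec;
  gns_cyclic : closure (range (fun a => gns_rep a gns_vec)) = setT
}.

Definition unitarily_equivalent (H1 H2 : hilbertType R)
    (p1 : representation H1) (p2 : representation H2) : Prop :=
  exists U : {linear H1 -> H2},
    [/\ bijective U, (forall x y, hdot (U x) (U y) = hdot x y) &
        (forall a x, U (p1 a x) = p2 a (U x))].

Definition state_equiv (w1 w2 : state) : Prop :=
  exists (G1 : gns w1) (G2 : gns w2),
    unitarily_equivalent (gns_rep G1) (gns_rep G2).

End States.

Section Minimality.
Context {n : ngen} {A : cstarAlgType R} (s : letter n -> A).

(* The adjoint of the operator representing a is the operator representing
   [star a], see [rep_star]. *)
Definition K_space (w : state) (G : @gns A w) : set (gns_space G) :=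
  clspan [set x | exists J : word n,
                    x = gns_rep G (star (wordprod s J)) (gns_vec G)].

(* The dimension does not depend on the GNS triple. *)
Definition cdim (w : @state A) : \bar R :=
  xget 0%E [set d | exists G : gns w, d = hdim (@K_space w G)].

(* The smallest element of the set of the dimensions [cdim w']. *)
Definition kappa (w : @state A) : \bar R :=
  let D := [set cdim w' | w' in [set w' | state_equiv w' w]] in
  xget 0%E [set d | D d /\ lbound D d].

Definition minimal (w : @state A) : Prop := cdim w = kappa w.

End Minimality.

End Cuntz.

(* Main.v *)
Require Import Defs.
From mathcomp Require Import all_boot all_order all_algebra.
From mathcomp Require Import all_classical all_reals all_analysis.
From mathcomp Require Import ring.

(** Why the theorem is true. Let w' be equivalent to w. Since their GNS
    representations are unitarily equivalent, w' is a vector state of the GNS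
    representation p of w, for some cyclic vector v' ([state_equiv_vector]).
    Let K' be the closed span of the vectors p(s_J)^* v'. The claim is that the
    GNS vector v of w lies in K'. As K' is invariant under every p(s_J)^*, it
    then contains the whole space K(w), whence cdim w <= cdim w'.

    From w(u) = 1 and the equality case of Cauchy-Schwarz, p(u) v = v, so that
    p(u)^* v = v as well. The monomials s_J s_L^* span a dense subspace of the
    algebra, so v is a limit of vectors p(m) v' with m a combination of
    monomials; let k bound the lengths of the words J that occur in m. Each
    application of u^*, being a limit of combinations of the s_I^* with I
    nonempty, shortens the left words by at least one letter; after k steps only
    the s_L^* remain, so that the k-th power T of p(u)^* maps p(m) v' into K'
    ([iter_star_plus_filtration], [K_space_filtration]). But p(u)^* is a
    contraction fixing v, so T p(m) v' is at least as close to v as p(m) v'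
    was. Hence v is in the closure of K', which is K'
    ([fixed_vector_in_K_space]).

    The rest makes the dimensions meaningful. K(w) is the closed span of a
    sequence, so Gram-Schmidt gives an orthonormal basis, and Bessel's inequality
    bounds the size of any finite orthonormal family in K(w) by that of a finite
    basis. Thus [hdim] is determined by which finite orthonormal families exist
    ([hdim_le]). This yields monotonicity and, because the Gram matrix of the
    vectors p(a) v is w(b^* a), independence of the GNS triple ([cdim_hdim]). *)

Set Implicit Arguments.
Unset Strict Implicit.
Unset Printing Implicit Defensive.

Import Order.TTheory GRing.Theory Num.Theory.

Local Open Scope classical_set_scope.
Local Open Scope ring_scope.
Local Open Scope cstar_scope.

(** * Closed subspaces of normed modules *)

Section ClosedSpans.
Context {K : numFieldType}.

Lemma closure_normP (V : normedModType K) (S : set V) (x : V) :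
  closure S x <-> forall e : K, 0 < e -> exists2 y, S y & `|x - y| < e.
Proof.
split=> [clS e e0|h B /nbhs_ballP [e /= e0 eB]].
  by have [y [Sy]] := clS _ (nbhsx_ballx x e e0); rewrite -ball_normE; exists y.
by have [y Sy xy] := h _ e0; exists y; split=> //; apply: eB; rewrite -ball_normE.
Qed.

Lemma continuous_additive (V W : normedModType K) (f : V -> W) (M : K) :
  0 <= M -> (forall x y, f (x + y) = f x + f y) ->
  (forall x, `|f x| <= M * `|x|) -> continuous f.
Proof.
move=> M0 fD fM x; apply/cvgrPdist_lt => e e0.
have fB y : f x - f y = f (x - y).
  by apply/eqP; rewrite subr_eq -fD subrK.
have M1 : 0 < M + 1 by rewrite ltr_wpDl.
apply/nbhs_normP; exists (e / (M + 1)) => [|y /=]; first by rewrite /= divr_gt0.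
rewrite fB ltr_pdivlMr // => xy; apply: le_lt_trans (fM _) _.
by apply: le_lt_trans xy; rewrite mulrC ler_wpM2l // lerDl ler01.
Qed.

(** A predicate on sets, so that closure properties can be pulled back along
    continuous maps and proved on generators only, see [clspan_min]. *)
Definition closed_subspace (V : normedModType K) (C : set V) : Prop :=
  [/\ closed C, C 0, (forall x y, C x -> C y -> C (x + y)) &
      (forall (c : K) x, C x -> C (c *: x))].

(** The twist g covers the conjugate-linear involution together with linear
    maps. *)
Lemma closed_subspace_preimage (V W : normedModType K) (f : V -> W)
    (g : K -> K) (C : set W) :
  continuous f -> (forall x y, f (x + y) = f x + f y) ->
  (forall c x, f (c *: x) = g c *: f x) -> closed_subspace C ->
  closed_subspace (f @^-1` C).
Proof.
move=> fc fD fZ [Ccl C0 CD CZ]; split.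
- by move/continuous_closedP: fc; exact.
- have f0 : f 0 = 0 by apply: (addrI (f 0)); rewrite -fD !addr0.
  by rewrite /preimage/= f0.
- by move=> x y; rewrite /preimage /= fD; exact: CD.
- by move=> c x; rewrite /preimage /= fZ; exact: CZ.
Qed.

Section Span.
Context {V : normedModType K}.
Implicit Types (S C : set V).

Lemma lspan_gen S x : S x -> lspan S x.
Proof.
move=> Sx; exists 1%N, (fun=> 1), (fun=> x); split=> //.
by rewrite big_ord1 scale1r.
Qed.

Lemma lspan0 S : lspan S 0.
Proof.
by exists 0%N, (fun=> 0), (fun=> 0); split=> [[]//|]; rewrite big_ord0.
Qed.

Lemma lspanD S x y : lspan S x -> lspan S y -> lspan S (x + y).
Proof.
move=> [m [c [f [Sf ->]]]] [p [d [g [Sg ->]]]].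
exists (m + p)%N,
  (fun i => match fintype.split i with inl j => c j | inr j => d j end),
  (fun i => match fintype.split i with inl j => f j | inr j => g j end); split.
  by move=> i; case: fintype.split.
rewrite big_split_ord /=; congr (_ + _); apply: eq_bigr => i _.
  by rewrite (unsplitK (inl i)).
by rewrite (unsplitK (inr i)).
Qed.

Lemma lspanZ S (c : K) x : lspan S x -> lspan S (c *: x).
Proof.
move=> [m [d [f [Sf ->]]]]; exists m, (fun i => c * d i), f; split=> //.
by rewrite scaler_sumr; apply: eq_bigr => i _; rewrite scalerA.
Qed.

Lemma lspanB S x y : lspan S x -> lspan S y -> lspan S (x - y).
Proof. by move=> Sx Sy; apply: lspanD => //; rewrite -scaleN1r; exact: lspanZ. Qed.

Lemma lspan_min S C : C 0 -> (forall x y, C x -> C y -> C (x + y)) ->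
  (forall (c : K) x, C x -> C (c *: x)) -> S `<=` C -> lspan S `<=` C.
Proof.
move=> C0 CD CZ SC _ [m [c [f [Sf ->]]]].
by elim/big_ind: _ => // i _; apply: CZ; exact: SC.
Qed.

Lemma lspan_sum S (I : Type) (r : seq I) (P : pred I) (c : I -> K) (f : I -> V) :
  (forall i, P i -> lspan S (f i)) -> lspan S (\sum_(i <- r | P i) c i *: f i).
Proof.
move=> Sf; elim/big_ind: _ => [|x y|i /Sf]; first exact: lspan0.
- exact: lspanD.
- exact: lspanZ.
Qed.

Lemma sub_clspan S : S `<=` clspan S.
Proof. by move=> x Sx; apply: subset_closure; exact: lspan_gen. Qed.

Lemma closed_subspace_clspan S : closed_subspace (clspan S).
Proof.
split; first exact: closed_closure.
- by apply: subset_closure; exact: lspan0.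
- move=> x y /closure_normP Sx /closure_normP Sy; apply/closure_normP => e e0.
  have e20 : 0 < e / 2 by rewrite divr_gt0.
  have [x' Sx' xx'] := Sx _ e20; have [y' Sy' yy'] := Sy _ e20.
  exists (x' + y'); first exact: lspanD.
  rewrite opprD addrACA; apply: le_lt_trans (ler_normD _ _) _.
  by rewrite (splitr e) ltrD.
- move=> c x /closure_normP Sx.
  have [->|c0] := eqVneq c 0.
    by rewrite scale0r; apply: subset_closure; exact: lspan0.
  apply/closure_normP => e e0.
  have ec0 : 0 < e / `|c| by rewrite divr_gt0 ?normr_gt0.
  have [x' Sx' xx'] := Sx _ ec0; exists (c *: x'); first exact: lspanZ.
  by rewrite -scalerBr normrZ mulrC -ltr_pdivlMr ?normr_gt0.
Qed.

(** The induction principle used throughout: to prove a property on a closed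
    span, check that it cuts out a closed subspace and holds on generators. *)
Lemma clspan_min S C : closed_subspace C -> S `<=` C -> clspan S `<=` C.
Proof.
move=> [Ccl C0 CD CZ] SC; rewrite [C](closure_id _).1 //.
by apply: closureS; exact: lspan_min.
Qed.

End Span.
End ClosedSpans.

(** * Inner products, Bessel's inequality and Gram-Schmidt *)

Section InnerProduct.
Context {R : realType} {H : hilbertType R}.
Implicit Types x y z : H.

Lemma hdotDl x y z : hdot (x + y) z = hdot x z + hdot y z.
Proof. exact: linearDl. Qed.

Lemma hdotDr x y z : hdot z (x + y) = hdot z x + hdot z y.
Proof. exact: linearDr. Qed.

Lemma hdotNl x z : hdot (- x) z = - hdot x z.
Proof. exact: linearNl. Qed.

Lemma hdotNr x z : hdot z (- x) = - hdot z x.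
Proof. exact: linearNr. Qed.

Lemma hdotZl (c : R[i]) x y : hdot (c *: x) y = c * hdot x y.
Proof. exact: linearZl_LR. Qed.

Lemma hdotZr (c : R[i]) x y : hdot x (c *: y) = c^* * hdot x y.
Proof. exact: linearZr_LR. Qed.

Lemma hdotC x y : hdot x y = (hdot y x)^*.
Proof. by rewrite hermC expr0 mul1r. Qed.

Lemma hdot_suml (I : Type) (r : seq I) (c : I -> R[i]) (f : I -> H) y :
  hdot (\sum_(i <- r) c i *: f i) y = \sum_(i <- r) c i * hdot (f i) y.
Proof.
rewrite linear_sumlz; apply: eq_bigr => i _; exact: hdotZl.
Qed.

Lemma hdot_sumr (I : Type) (r : seq I) (c : I -> R[i]) (f : I -> H) y :
  hdot y (\sum_(i <- r) c i *: f i) = \sum_(i <- r) (c i)^* * hdot y (f i).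
Proof.
rewrite linear_sumr; apply: eq_bigr => i _; exact: hdotZr.
Qed.

Lemma normrB_sqr x y :
  `|x - y| ^+ 2 = `|x| ^+ 2 - hdot x y - hdot y x + `|y| ^+ 2.
Proof.
rewrite -!hdot_norm hdotDl !hdotDr !hdotNl !hdotNr opprK; ring.
Qed.

(** The equality case of Cauchy-Schwarz for vectors of equal norm, by expanding
    the square of [`|x - y|]. *)
Lemma hdot_eq_norm x y :
  hdot x y = `|x| ^+ 2 -> `|x| = `|y| -> x = y.
Proof.
move=> xy nxy; apply/eqP; rewrite -subr_eq0 -normr_eq0 -sqrf_eq0.
rewrite normrB_sqr (hdotC y) xy -nxy rmorphXn /=.
rewrite (conj_Creal (ger0_real (normr_ge0 x))).
by apply/eqP; ring.
Qed.

End InnerProduct.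

Section Orthonormal.
Context {R : realType} {H : hilbertType R}.
Implicit Types (x y z : H) (r f : seq H).

(** Finite orthonormal families are duplicate-free lists rather than indexed
    families: projections, extensions and images are then list operations. *)
Definition orthonormal_seq r : Prop := uniq r /\ orthonormal_set [set` r].

Definition hproj r y : H := \sum_(e <- r) hdot y e *: e.

Lemma hdot_hproj r y e : orthonormal_seq r -> e \in r ->
  hdot (hproj r y) e = hdot y e.
Proof.
move=> [ur or] er; rewrite hdot_suml (bigD1_seq e) //= (or e e) // eqxx mulr1.
rewrite big_seq_cond big1 ?addr0 // => i /andP[ir /negPf ie].
by rewrite (or i e) // ie mulr0.
Qed.

Lemma hdot_hproj_sub r y z : orthonormal_seq r ->
  hdot (y - hproj r y) (hproj r z) = 0.
Proof.
move=> or; rewrite hdot_sumr big_seq big1 // => e er.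
by rewrite hdotDl hdotNl hdot_hproj // subrr mulr0.
Qed.

Lemma hproj_sqr r y : orthonormal_seq r ->
  `|hproj r y| ^+ 2 = \sum_(e <- r) `|hdot y e| ^+ 2.
Proof.
move=> or; rewrite -hdot_norm {2}/hproj hdot_sumr big_seq [RHS]big_seq.
by apply: eq_bigr => e er; rewrite hdot_hproj // normCK mulrC.
Qed.

Lemma hproj_pythagoras r y : orthonormal_seq r ->
  `|y| ^+ 2 = `|hproj r y| ^+ 2 + `|y - hproj r y| ^+ 2.
Proof.
move=> or; have yE : y = hproj r y + (y - hproj r y) by rewrite addrC subrK.
have h1 := hdot_hproj_sub y y or.
have h2 : hdot (hproj r y) (y - hproj r y) = 0 by rewrite hdotC h1 conjC0.
rewrite -hdot_norm {1 2}yE hdotDl (hdotDr _ (y - _)) h2 addr0.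
by rewrite (hdotDr _ (y - _)) h1 add0r !hdot_norm.
Qed.

Lemma hproj_norm r y : orthonormal_seq r -> `|hproj r y| <= `|y|.
Proof.
move=> or; rewrite -(@ler_pXn2r _ 2) ?nnegrE // (hproj_pythagoras y or).
by rewrite lerDl exprn_ge0.
Qed.

Lemma hprojB r y z : hproj r (y - z) = hproj r y - hproj r z.
Proof.
rewrite /hproj -sumrB; apply: eq_bigr => e _.
by rewrite hdotDl hdotNl scalerBl.
Qed.

Lemma hproj_span r y : lspan [set` r] (hproj r y).
Proof.
by rewrite /hproj big_seq; apply: lspan_sum => e er; apply: lspan_gen.
Qed.

Lemma hproj_lspan r z : orthonormal_seq r -> lspan [set` r] z -> hproj r z = z.
Proof.
move=> or [m [c [x [xr ->]]]]; rewrite /hproj.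
under eq_bigr do rewrite hdot_suml scaler_suml.
rewrite exchange_big; apply: eq_bigr => i _ /=.
rewrite (bigD1_seq (x i)) ?(or.1) //=; last exact: xr.
rewrite or.2 ?eqxx ?mulr1; try exact: xr.
rewrite big_seq_cond big1 ?addr0 // => e /andP[er /negPf ex].
by rewrite or.2 // 1?eq_sym ?ex ?mulr0 ?scale0r //; exact: xr.
Qed.

(** The projection is a contraction that is the identity on the span, hence
    on its closure. *)
Lemma hproj_clspan r y : orthonormal_seq r -> clspan [set` r] y -> hproj r y = y.
Proof.
move=> or /closure_normP cy; apply/eqP; rewrite -subr_eq0 -normr_le0.
apply/ler_addgt0Pr => e e0; rewrite add0r.
have e20 : 0 < e / 2 by rewrite divr_gt0.
have [z zr yz] := cy _ e20.
have -> : hproj r y - y = hproj r (y - z) - (y - z).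
  by rewrite hprojB (hproj_lspan or zr) opprB addrA subrK.
apply: le_trans (ler_normB _ _) _; rewrite (splitr e) lerD //.
  by apply: le_trans (hproj_norm _ or) _; exact: ltW.
exact: ltW.
Qed.

(** Double counting of the squares [`|hdot x e| ^+ 2] over the two families:
    summed over e they give 1 for each x of f, and summed over x at most 1 for
    each e of r, by Bessel's inequality. *)
Lemma orthonormal_seq_size r f : orthonormal_seq r -> orthonormal_seq f ->
  [set` f] `<=` clspan [set` r] -> (size f <= size r)%N.
Proof.
move=> or of_ fr; rewrite -(ler_nat R[i]).
have norm1 s x : orthonormal_seq s -> x \in s -> `|x| ^+ 2 = 1 :> R[i].
  by move=> os xs; rewrite -hdot_norm os.2 ?eqxx.
have sumn1 (s : seq H) : (size s)%:R = \sum_(x <- s) 1 :> R[i].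
  by rewrite big_const_seq count_predT iter_addr_0.
rewrite !sumn1.
have -> : \sum_(x <- f) 1 = \sum_(x <- f) \sum_(e <- r) `|hdot x e| ^+ 2 :> R[i].
  rewrite big_seq [RHS]big_seq; apply: eq_bigr => x xf.
  by rewrite -hproj_sqr // hproj_clspan ?(norm1 f) //; exact: fr.
rewrite exchange_big /= big_seq [leRHS]big_seq; apply: ler_sum => e er.
rewrite -(norm1 r e or er) (hproj_pythagoras e of_) hproj_sqr //.
under eq_bigr do rewrite hdotC norm_conjC.
by rewrite lerDl exprn_ge0.
Qed.

Lemma orthonormal_seq_rcons r y : orthonormal_seq r ->
  y != hproj r y ->
  orthonormal_seq (rcons r (`|y - hproj r y|^-1 *: (y - hproj r y))).
Proof.
move=> or yr; set z := y - hproj r y; set e := _ *: z.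
have nz0 : `|z| != 0 by rewrite normr_eq0 subr_eq0.
have ez x : x \in r -> hdot e x = 0.
  by move=> xr; rewrite hdotZl hdotDl hdotNl hdot_hproj // subrr mulr0.
have ee : hdot e e = 1.
  rewrite hdotZl hdotZr hdot_norm conj_Creal; last by rewrite rpredV normr_real.
  by rewrite mulrA -invfM -expr2 mulVf // expf_neq0.
have er x : x \in r -> x == e = false.
  move=> xr; apply/eqP => xe; have := ez _ xr; rewrite xe ee => /eqP.
  by rewrite oner_eq0.
split; first by rewrite rcons_uniq or.1 andbT; apply/negP => /er; rewrite eqxx.
move=> x x'; rewrite /= !mem_rcons !inE => /orP[/eqP->|xr] /orP[/eqP->|x'r].
- by rewrite ee eqxx.
- by rewrite ez // eq_sym er.
- by rewrite hdotC ez // er // conjC0.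
- exact: or.2.
Qed.

End Orthonormal.

Section GramSchmidt.
Context {R : realType} {H : hilbertType R}.
Variable x : nat -> H.

(** A vector already in the span of its predecessors is skipped, so dependent
    and repeated vectors are allowed in x. *)
Fixpoint gram_schmidt (k : nat) : seq H :=
  if k is k'.+1 then
    let r := gram_schmidt k' in
    if x k' == hproj r (x k') then r
    else rcons r (`|x k' - hproj r (x k')|^-1 *: (x k' - hproj r (x k')))
  else [::].

Lemma gram_schmidt_orthonormal k : orthonormal_seq (gram_schmidt k).
Proof.
elim: k => [|k IH] /=; first by split=> // ? ?.
by case: eqVneq => // xk; exact: orthonormal_seq_rcons.
Qed.

Lemma gram_schmidt_mono j k : (j <= k)%N ->
  {subset gram_schmidt j <= gram_schmidt k}.
Proof.
move=> /subnK <-; elim: (k - j)%N => [//|m IH] e /IH em.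
by rewrite addSn /=; case: ifP => // _; rewrite mem_rcons inE em orbT.
Qed.

Lemma gram_schmidt_lspan k : [set` gram_schmidt k] `<=` lspan (range x).
Proof.
elim: k => [//|k IH] /=; case: ifP => // _ e /=.
have xk : lspan (range x) (x k) by apply: lspan_gen; exists k.
rewrite mem_rcons inE => /orP[/eqP->|/IH //].
apply: lspanZ; apply: lspanB => //.
by rewrite /hproj big_seq; apply: lspan_sum => e' /IH.
Qed.

Lemma gram_schmidt_gen k : lspan [set` gram_schmidt k.+1] (x k).
Proof.
rewrite /=; case: eqVneq => [->|xk]; first exact: hproj_span.
set r := gram_schmidt k; set z := x k - _; set e := _ *: z.
have nz0 : `|z| != 0 by rewrite normr_eq0 subr_eq0.
have -> : x k = `|z| *: e + hproj r (x k).
  by rewrite /e scalerA divff // scale1r /z subrK.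
apply: lspanD.
  by apply: lspanZ; apply: lspan_gen; rewrite /= mem_rcons inE eqxx.
rewrite /hproj big_seq; apply: lspan_sum => e' er.
by apply: lspan_gen; rewrite /= mem_rcons inE er orbT.
Qed.

Lemma gram_schmidt_basis :
  orthonormal_basis (clspan (range x)) (\bigcup_k [set` gram_schmidt k]).
Proof.
split.
  move=> e f [j _ ej] [k _ fk].
  apply: (gram_schmidt_orthonormal (maxn j k)).2.
  - exact: gram_schmidt_mono (leq_maxl _ _) _ ej.
  - exact: gram_schmidt_mono (leq_maxr _ _) _ fk.
apply/seteqP; split; apply: clspan_min; try exact: closed_subspace_clspan.
  by move=> e [k _ /gram_schmidt_lspan ek]; exact: subset_closure.
move=> _ [k _ <-]; apply: subset_closure.
apply: lspan_min (gram_schmidt_gen k); [exact: lspan0| | |].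
- by move=> *; exact: lspanD.
- by move=> *; exact: lspanZ.
- by move=> e ek; apply: lspan_gen; exists k.+1.
Qed.

End GramSchmidt.

(** * Dimension of closed spans of sequences *)

Section HilbertDim.
Context {R : realType}.

Lemma orthonormal_seq_map (H H' : hilbertType R) (g : H -> H') (r : seq H) :
  orthonormal_seq r ->
  (forall x y, x \in r -> y \in r -> hdot (g x) (g y) = hdot x y) ->
  orthonormal_seq (map g r).
Proof.
move=> [ur or] gr.
have ginj : {in r &, injective g}.
  move=> x y xr yr gxy; apply/eqP; have := gr _ _ xr xr.
  rewrite {2}gxy gr // !or // eqxx.
  by case: (x == y) => // /eqP; rewrite eq_sym oner_eq0.
split; first by rewrite map_inj_in_uniq.
move=> _ _ /mapP[x xr ->] /mapP[y yr ->]; rewrite gr // or //.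
by rewrite (inj_in_eq ginj).
Qed.

Definition has_orthonormal (H : hilbertType R) (C : set H) (a : nat) : Prop :=
  exists r : seq H, [/\ orthonormal_seq r, size r = a & [set` r] `<=` C].

(** The value that [hdim] assigns to an orthonormal basis E. *)
Definition hcard (H : hilbertType R) (E : set H) (d : \bar R) : Prop :=
  (exists2 m : nat, (E #= `I_m)%card & d = m%:R%:E) \/
  (infinite_set E /\ d = +oo%E).

Lemma hcard_orthonormal (H : hilbertType R) (E : set H) d a :
  orthonormal_set E -> hcard E d -> (a%:R%:E <= d)%E -> has_orthonormal E a.
Proof.
move=> oE Ed ad.
have enough_elements :
    (exists2 s : seq H, uniq s /\ [set` s] `<=` E & (a <= size s)%N) ->
    has_orthonormal E a.
  move=> [s [us sE] las]; exists (take a s); split.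
  - split; first exact: take_uniq.
    by move=> e f /= /mem_take/sE eE /mem_take/sE fE; exact: oE.
  - exact: size_takel.
  - by move=> e /= /mem_take; exact: sE.
apply: enough_elements; case: Ed ad => [[m Em ->]|[iE _] _]; last first.
  have [B BE aB] := infinite_set_fset a iE.
  by exists (finmap.enum_fset B) => //; split=> //; exact: finmap.fset_uniq.
rewrite lee_fin ler_nat => am.
move/card_esym/card_set_bijP : Em => [g [gE ginj _]].
exists (map g (iota 0 m)); last by rewrite size_map size_iota.
split.
  rewrite map_inj_in_uniq ?iota_uniq // => i j.
  by rewrite !mem_iota !add0n => im jm; apply: ginj; rewrite inE.
by move=> _ /mapP[i im ->]; apply: gE; move: im; rewrite mem_iota.
Qed.

Lemma basis_bound (H : hilbertType R) (K E : set H) (m a : nat) :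
  orthonormal_basis K E -> (E #= `I_m)%card -> has_orthonormal K a -> (a <= m)%N.
Proof.
move=> [oE EK] Em [f [of_ <- fK]].
move/card_esym/card_set_bijP : Em => [g [gE ginj gsurj]].
pose r := map g (iota 0 m).
have rE : [set` r] = E.
  apply/seteqP; split=> e /=.
    by move=> /mapP[i im ->]; apply: gE; move: im; rewrite mem_iota.
  by move=> /gsurj[i im <-]; apply: map_f; rewrite mem_iota.
have -> : m = size r by rewrite size_map size_iota.
apply: orthonormal_seq_size => //; last by rewrite rE EK.
split; last by rewrite rE.
rewrite map_inj_in_uniq ?iota_uniq // => i j.
by rewrite !mem_iota !add0n => im jm; apply: ginj; rewrite inE.
Qed.

Lemma sub_has_orthonormal (H : hilbertType R) (C D : set H) a :
  C `<=` D -> has_orthonormal C a -> has_orthonormal D a.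
Proof. by move=> CD [r [or ra rC]]; exists r; split=> // e /rC/CD. Qed.

Lemma hcardP (H : hilbertType R) (E : set H) : exists d, hcard E d.
Proof.
have [[m Em]|iE] := pselect (finite_set E).
- by exists m%:R%:E; left; exists m.
- by exists +oo%E; right.
Qed.

(** A larger cardinality on the left would provide an orthonormal family in K
    that exceeds the basis on the right. *)
Lemma hcard_le (H : hilbertType R) (K E E' : set H) d d' :
  orthonormal_basis K E -> orthonormal_basis K E' ->
  hcard E d -> hcard E' d' -> (d <= d')%E.
Proof.
move=> bE bE' Ed [[m Em ->]|[_ ->]]; last exact: leey.
have bound a : (a%:R%:E <= d)%E -> (a <= m)%N.
  move=> /(hcard_orthonormal bE.1 Ed) oa; apply: basis_bound bE' Em _.
  by apply: sub_has_orthonormal oa; rewrite -bE.2; exact: sub_clspan.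
case: Ed bound => [[k _ ->]|[_ ->]] bound.
  by rewrite lee_fin ler_nat bound.
by have := bound m.+1 (leey _); rewrite ltnn.
Qed.

Lemma hdim_basis (H : hilbertType R) (K E : set H) :
  orthonormal_basis K E -> hcard E (hdim K).
Proof.
move=> bE; have [d Ed] := hcardP E.
suff -> : hdim K = d by [].
apply: xget_unique; first by exists E; split.
move=> d' [E' [bE' E'd']].
by apply/eqP; rewrite eq_le (hcard_le bE' bE) ?(hcard_le bE bE').
Qed.

(** The basis consists of vectors of the algebraic span, which is what lets
    orthonormal families be transported between GNS triples. *)
Lemma lspan_basis (H : hilbertType R) (x : nat -> H) :
  exists2 E, orthonormal_basis (clspan (range x)) E & E `<=` lspan (range x).
Proof.
exists (\bigcup_k [set` gram_schmidt x k]); first exact: gram_schmidt_basis.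
by move=> e [k _ /gram_schmidt_lspan].
Qed.

(** The dimension is the supremum of the sizes of finite orthonormal families,
    and it is enough to look for those in the algebraic span. The two spaces may
    live in different Hilbert spaces, which serves to compare GNS triples. *)
Lemma hdim_le (H H' : hilbertType R) (x : nat -> H) (x' : nat -> H') :
  (forall a, has_orthonormal (lspan (range x)) a ->
             has_orthonormal (clspan (range x')) a) ->
  (hdim (clspan (range x)) <= hdim (clspan (range x')))%E.
Proof.
move=> xx'; have [E bE Ex] := lspan_basis x.
have [E' bE' _] := lspan_basis x'.
have Ed := hdim_basis bE; have [[m' Em' ->]|[_ ->]] := hdim_basis bE'; last first.
  exact: leey.
have bound a : (a%:R%:E <= hdim (clspan (range x)))%E -> (a <= m')%N.
  move=> /(hcard_orthonormal bE.1 Ed) oa; apply: basis_bound bE' Em' _.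
  by apply: xx'; exact: sub_has_orthonormal oa.
case: Ed bound => [[k _ ->]|[_ ->]] bound.
  by rewrite lee_fin ler_nat bound.
by have := bound m'.+1 (leey _); rewrite ltnn.
Qed.

End HilbertDim.

(** * Continuity of the operations of a C*-algebra *)

Section CStarAlgebra.
Context {R : realType} {A : cstarAlgType R}.
Implicit Types (a b : A) (C : set A).

Lemma star_cone : star \1 = \1 :> A.
Proof.
have h : star (star \1 ** \1) = \1 :> A by rewrite cmul1r starK.
by rewrite -[RHS]h starM starK cmul1r.
Qed.

(** The C*-identity and submultiplicativity give
    [`|b| ^+ 2 <= `|star b| * `|b|]. *)
Lemma star_norm a : `|star a| = `|a|.
Proof.
have le b : `|b| <= `|star b|.
  have [->|b0] := eqVneq b 0; first by rewrite normr0.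
  by rewrite -(ler_pM2r (x := `|b|)) ?normr_gt0 // -expr2 -cstar_norm cmul_norm.
by apply/eqP; rewrite eq_le le -{2}[a]starK le.
Qed.

Lemma closed_subspace_cmull b C :
  closed_subspace C -> closed_subspace (cmul b @^-1` C).
Proof.
apply: (closed_subspace_preimage (g := id)).
- apply: (@continuous_additive _ _ _ _ `|b|) => // *; first exact: cmulDr.
  exact: cmul_norm.
- by move=> *; exact: cmulDr.
- by move=> *; exact: cmulZr.
Qed.

Lemma closed_subspace_cmulr b C :
  closed_subspace C -> closed_subspace ((fun a => a ** b) @^-1` C).
Proof.
apply: (closed_subspace_preimage (g := id)).
- apply: (@continuous_additive _ _ _ _ `|b|) => // *; first exact: cmulDl.
  by rewrite mulrC; exact: cmul_norm.
- by move=> *; exact: cmulDl.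
- by move=> *; exact: cmulZl.
Qed.

Lemma closed_subspace_star C :
  closed_subspace C -> closed_subspace (star @^-1` C).
Proof.
apply: (closed_subspace_preimage (g := Num.conj)).
- apply: (@continuous_additive _ _ _ _ 1) => // *; first exact: starD.
  by rewrite mul1r star_norm.
- by move=> *; exact: starD.
- by move=> *; exact: starZ.
Qed.

End CStarAlgebra.

(** * Monomials in Cuntz generators *)

Section Monomials.
Context {R : realType} {n : ngen} {A : cstarAlgType R} (s : letter n -> A).
Hypothesis orth : forall i j, star (s i) ** s j = (i == j)%:R *: \1.
Implicit Types (J L I : word n).

Lemma wordprod_cat J L : wordprod s (J ++ L) = wordprod s J ** wordprod s L.
Proof. by elim: J => [|j J IH] /=; rewrite ?cmul1l // IH cmulA. Qed.

Definition monomial J L : A := wordprod s J ** star (wordprod s L).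

(** Multiplying by [star (s i)] either removes the first letter of the left
    word, possibly killing the monomial, or, when the left word is empty,
    lengthens the right word. *)
Lemma star_letter_monomial i J L : exists c J' L',
  (size J' <= (size J).-1)%N /\
  star (s i) ** monomial J L = c *: monomial J' L'.
Proof.
case: J => [|j J] /=.
  exists 1, [::], (rcons L i); split=> //.
  by rewrite scale1r /monomial /= !cmul1l -cats1 wordprod_cat starM /= cmul1r.
exists (i == j)%:R, J, L; split=> //.
by rewrite /monomial /= !cmulA orth cmulZl cmul1l cmulZl.
Qed.

(** Level 0 is the closed span of the adjoints [star (wordprod s L)], and the
    levels together exhaust the monomials. *)
Definition filtration k : set A :=
  clspan [set a | exists J L, (size J <= k)%N /\ a = monomial J L].

Lemma filtration_closed k : closed_subspace (filtration k).
Proof. exact: closed_subspace_clspan. Qed.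

Lemma filtration_mono j k : (j <= k)%N -> filtration j `<=` filtration k.
Proof.
move=> jk; apply: clspan_min; first exact: filtration_closed.
move=> _ [J [L [Jj ->]]]; apply: sub_clspan; exists J, L; split=> //.
exact: leq_trans jk.
Qed.

Lemma star_letter_filtration i k a :
  filtration k a -> filtration k.-1 (star (s i) ** a).
Proof.
have Fc := filtration_closed k.-1; have [_ _ _ FZ] := Fc.
move: a; apply: clspan_min; first exact: closed_subspace_cmull.
move=> _ [J [L [Jk ->]]]; have [c [J' [L' [J'J]]]] := star_letter_monomial i J L.
rewrite /preimage /= => ->; apply: FZ; apply: sub_clspan; exists J', L'; split=> //.
by apply: leq_trans J'J _; rewrite -!subn1 leq_sub2r.
Qed.

Lemma star_word_filtration J k a :
  filtration k a -> filtration k (star (wordprod s J) ** a).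
Proof.
elim: J a => [|j J IH] a Fa /=; first by rewrite star_cone cmul1l.
rewrite starM -cmulA; apply: IH; apply: filtration_mono (leq_pred k) _ _.
exact: star_letter_filtration.
Qed.

(** An element of O_n^+ is a limit of combinations of nonempty words, and the
    first letter of each of them already lowers the level by one. *)
Lemma star_plus_filtration u k a :
  cuntz_plus s u -> filtration k a -> filtration k.-1 (star u ** a).
Proof.
move=> us Fa; move: u us; apply: clspan_min.
  have := closed_subspace_cmulr a (filtration_closed k.-1).
  exact: closed_subspace_star.
move=> _ [[|j J] // _ ->]; rewrite /preimage /= starM -cmulA.
by apply: star_word_filtration; exact: star_letter_filtration.
Qed.

Lemma iter_star_plus_filtration u k a : cuntz_plus s u ->
  filtration k a -> filtration 0 (iter k (cmul (star u)) a).
Proof.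
move=> us; elim: k a => [//|k IH] a Fa.
by rewrite iterSr; apply: IH; exact: (star_plus_filtration us Fa).
Qed.

Definition monomials : set A := [set a | exists J L, a = monomial J L].

Lemma lspan_monomials_filtration a :
  lspan monomials a -> exists k, filtration k a.
Proof.
move: a; apply: (@lspan_min _ _ _ [set a | exists k, filtration k a]).
- by exists 0%N; have [] := filtration_closed 0.
- move=> a b [j Fa] [k Fb]; exists (maxn j k).
  have [_ _ FD _] := filtration_closed (maxn j k).
  by apply: FD; [move: Fa|move: Fb]; apply: filtration_mono;
    [exact: leq_maxl|exact: leq_maxr].
- move=> c a [k Fa]; exists k.
  by have [_ _ _ FZ] := filtration_closed k; exact: FZ.
- move=> _ [J [L ->]]; exists (size J); apply: sub_clspan.
  by exists J, L.
Qed.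

Lemma clspan_monomials_word J a :
  clspan monomials a -> clspan monomials (wordprod s J ** a).
Proof.
move: a; apply: clspan_min.
  by apply: closed_subspace_cmull; exact: closed_subspace_clspan.
move=> _ [J' [L ->]]; rewrite /preimage /= /monomial cmulA -wordprod_cat.
by apply: sub_clspan; exists (J ++ J'), L.
Qed.

Lemma clspan_monomials_star_word J a :
  clspan monomials a -> clspan monomials (star (wordprod s J) ** a).
Proof.
have Mc := @closed_subspace_clspan _ _ monomials; have [_ _ _ MZ] := Mc.
elim: J a => [|j J IH] a Ma /=; first by rewrite star_cone cmul1l.
rewrite starM -cmulA; apply: IH; move: a Ma; apply: clspan_min.
  exact: closed_subspace_cmull.
move=> _ [J' [L ->]]; have [c [J'' [L' [_]]]] := star_letter_monomial j J' L.
by rewrite /preimage /= => ->; apply: MZ; apply: sub_clspan; exists J'', L'.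
Qed.

(** Closure under products: left multiplication by a generator or its adjoint
    sends monomials to multiples of monomials, and multiplication by a monomial is
    a composition of such multiplications. *)
Lemma cstar_subalgebra_monomials : cstar_subalgebra (clspan monomials).
Proof.
have Mc := @closed_subspace_clspan _ _ monomials; have [Mcl M0 MD MZ] := Mc.
split=> //.
- apply: sub_clspan; exists [::], [::].
  by rewrite /monomial /= star_cone cmul1l.
- move=> a b + Mb; move: a; apply: clspan_min; first exact: closed_subspace_cmulr.
  move=> _ [J [L ->]]; rewrite /preimage /= /monomial -cmulA.
  by apply: clspan_monomials_word; exact: clspan_monomials_star_word.
- split=> //; apply: clspan_min; first exact: closed_subspace_star.
  move=> _ [J [L ->]]; apply: sub_clspan; exists L, J.
  by rewrite /monomial starM starK.
Qed.

Lemma monomials_letter i : clspan monomials (s i).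
Proof.
apply: sub_clspan; exists [:: i], [::].
by rewrite /monomial /= star_cone !cmul1r.
Qed.

End Monomials.

(** * Representations and GNS triples *)

Section Representations.
Context {R : realType} {A : cstarAlgType R}.

Section Vector.
Context {H : hilbertType R} (p : @representation R A H).
Implicit Types x y : H.

Lemma rep0 x : p 0 x = 0.
Proof. by rewrite -(scale0r (0 : A)) repZ scale0r. Qed.

Lemma repB a b x : p (a - b) x = p a x - p b x.
Proof. by rewrite repD -(scaleN1r b) repZ scaleN1r. Qed.

Lemma rep_iter u k a x : p (iter k (cmul u) a) x = iter k (p u) (p a x).
Proof. by elim: k => //= k <-; rewrite repM. Qed.

Lemma hdot_rep (a b : A) x : hdot (p a x) (p b x) = hdot (p (star b ** a) x) x.
Proof. by rewrite repM rep_star. Qed.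

Lemma rep_isometry u x : star u ** u = \1 -> `|p u x| = `|x|.
Proof.
move=> uu; apply/eqP; rewrite -(@eqrXn2 _ 2) // -!hdot_norm.
by rewrite hdot_rep uu rep1.
Qed.

(** The projection [u u^*] is a contraction: [`|x| ^+ 2 - `|u^* x| ^+ 2] is the
    square of the norm of [x - u u^* x]. *)
Lemma rep_coisometry u x : star u ** u = \1 -> `|p (star u) x| <= `|x|.
Proof.
move=> uu; set t := p (star u) x.
have xt : hdot x (p u t) = `|t| ^+ 2 by rewrite -rep_star hdot_norm.
rewrite -(@ler_pXn2r _ 2) ?nnegrE // -subr_ge0.
suff -> : `|x| ^+ 2 - `|t| ^+ 2 = `|x - p u t| ^+ 2 by rewrite exprn_ge0.
rewrite normrB_sqr (hdotC (p u t)) xt rep_isometry //.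
by rewrite rmorphXn /= (conj_Creal (ger0_real (normr_ge0 t))); ring.
Qed.

Lemma rep_fixed u x : star u ** u = \1 -> hdot (p u x) x = `|x| ^+ 2 -> p u x = x.
Proof.
by move=> uu ux; apply: hdot_eq_norm; rewrite rep_isometry.
Qed.

End Vector.

Section GNS.
Context {w : @state R A} (G : gns w).
Local Notation p := (gns_rep G).
Local Notation v := (gns_vec G).

Lemma hdot_gns (a b : A) : hdot (p a v) (p b v) = w (star b ** a).
Proof. by rewrite hdot_rep (gns_state G). Qed.

Lemma gns_vec_norm : `|v| ^+ 2 = 1.
Proof. by rewrite -hdot_norm -{1}(rep1 p v) -(gns_state G) state1. Qed.

(** Continuity in a of the orbit map of the cyclic vector. The reason is
    that [`|p a v| ^+ 2] is the value of the state at [star a ** a]. *)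
Lemma gns_norm_le (a : A) : `|p a v| <= `|a|.
Proof.
rewrite -(@ler_pXn2r _ 2) ?nnegrE // -hdot_norm hdot_gns -cstar_norm.
by rewrite -(ger0_norm (state_pos w a)) state_norm.
Qed.

Lemma closed_subspace_gns (C : set (gns_space G)) :
  closed_subspace C -> closed_subspace ((fun a => p a v) @^-1` C).
Proof.
apply: (closed_subspace_preimage (g := id)).
- apply: (@continuous_additive _ _ _ _ 1) => // *; first exact: repD.
  by rewrite mul1r gns_norm_le.
- by move=> *; exact: repD.
- by move=> *; exact: repZ.
Qed.

End GNS.

Lemma state_equiv_refl (w : @state R A) : gns w -> state_equiv w w.
Proof.
by move=> G; exists G, G, idfun; split=> //; exists idfun.
Qed.

Lemma unitary_norm (H H' : hilbertType R) (U : {linear H -> H'}) :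
  (forall x y, hdot (U x) (U y) = hdot x y) -> forall x, `|U x| = `|x|.
Proof.
by move=> Udot x; apply/eqP; rewrite -(@eqrXn2 _ 2) // -!hdot_norm Udot.
Qed.

(** The intertwining unitary carries the GNS vector of w' to a cyclic vector
    in the space of w, so the two states can be compared in one space. *)
Lemma state_equiv_vector (w' w : @state R A) : state_equiv w' w ->
  exists (G : gns w) (v : gns_space G),
    (forall a, w' a = hdot (gns_rep G a v) v) /\
    closure (range (fun a => gns_rep G a v)) = setT.
Proof.
move=> [G' [G [U [[V UK VK] Udot Uintw]]]]; exists G, (U (gns_vec G')); split.
  by move=> a; rewrite -Uintw Udot -gns_state.
apply/seteqP; split=> // y _; apply/closure_normP => e e0.
have : closure (range (fun a => gns_rep G' a (gns_vec G'))) (V y).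
  by rewrite gns_cyclic.
move=> /closure_normP/(_ _ e0)[_ [a _ <-] ya].
exists (gns_rep G a (U (gns_vec G'))); first by exists a.
by rewrite -Uintw -(VK y) -linearB unitary_norm.
Qed.

End Representations.

(** * The spaces K and minimality *)

Section Minimality.
Context {R : realType} {n : ngen} {A : cstarAlgType R} (s : letter n -> A).
Implicit Types (w : @state R A).

(** Gram-Schmidt needs the words listed in a sequence. *)
Lemma word_enumeration : exists g : nat -> word n, forall J, exists k, g k = J.
Proof.
rewrite /word; case: n => [m|].
  exists (fun k => odflt [::] (unpickle k : option (seq 'I_m))) => J.
  by exists (pickle (J : seq 'I_m)); rewrite pickleK.
exists (fun k => odflt [::] (unpickle k : option (seq nat))) => J.
by exists (pickle (J : seq nat)); rewrite pickleK.
Qed.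

Lemma adjoint_words_range (T : Type) (f : A -> T) (g : nat -> word n) :
  (forall J, exists k, g k = J) ->
  [set x | exists J, x = f (star (wordprod s J))] =
  range (fun k => f (star (wordprod s (g k)))).
Proof.
move=> gsurj; apply/seteqP; split=> [_ [J ->]|_ [k _ <-]]; last by exists (g k).
by have [k <-] := gsurj J; exists k.
Qed.

(** An orthonormal family in the span of the p1(s_J)^* v1 has the form
    p1(b) v1, and p2(b) v2 has the same Gram matrix since inner products of such
    vectors are values of w. *)
Lemma K_space_hdim_le w (G1 G2 : gns w) :
  (hdim (K_space s (G := G1)) <= hdim (K_space s (G := G2)))%E.
Proof.
have [g gsurj] := word_enumeration.
rewrite /K_space !(adjoint_words_range (fun a => gns_rep _ a _) gsurj).
set x1 := fun k => _; set x2 := fun k => _.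
apply: hdim_le => a [r [or ra rx1]].
(* One element b of the algebra represents e in the first triple and its copy
   in the second. *)
have lift : forall e, exists b, lspan (range x1) e ->
    e = gns_rep G1 b (gns_vec G1) /\ lspan (range x2) (gns_rep G2 b (gns_vec G2)).
  move=> e; have [ex1|] := pselect (lspan (range x1) e); last by exists 0.
  suff [b eb] : exists b, e = gns_rep G1 b (gns_vec G1) /\
      lspan (range x2) (gns_rep G2 b (gns_vec G2)) by exists b.
  move: e ex1; apply: (@lspan_min _ _ _ [set e | exists b, _]).
  - by exists 0; rewrite !rep0; split=> //; exact: lspan0.
  - move=> _ _ [b [-> b2]] [c [-> c2]]; exists (b + c); rewrite !repD; split=> //.
    exact: lspanD.
  - move=> c _ [b [-> b2]]; exists (c *: b); rewrite !repZ; split=> //.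
    exact: lspanZ.
  - move=> _ [k _ <-]; exists (star (wordprod s (g k))); split=> //.
    by apply: lspan_gen; exists k.
have [b bP] := choice lift.
exists (map (fun e => gns_rep G2 (b e) (gns_vec G2)) r); split.
- apply: orthonormal_seq_map => // e f er fr.
  have [eE _] := bP _ (rx1 _ er); have [fE _] := bP _ (rx1 _ fr).
  by rewrite [in RHS]eE [in RHS]fE !hdot_gns.
- by rewrite size_map.
- move=> _ /mapP[e er ->]; apply: subset_closure.
  by have [] := bP _ (rx1 _ er).
Qed.

Lemma cdim_hdim w (G : gns w) : cdim s w = hdim (K_space s (G := G)).
Proof.
apply: xget_unique; first by exists G.
by move=> _ [G' ->]; apply/eqP; rewrite eq_le !K_space_hdim_le.
Qed.

Hypothesis orth : forall i j, star (s i) ** s j = (i == j)%:R *: \1.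
Hypothesis generated : clspan (monomials s) = setT.

Section FixedVector.
Context w (G : gns w).
Local Notation p := (gns_rep G).
Local Notation v := (gns_vec G).
Local Notation K := (K_space s (G := G)).

Lemma K_space_filtration a : filtration s 0 a -> K (p a v).
Proof.
move: a; apply: clspan_min.
  by apply: closed_subspace_gns; exact: closed_subspace_clspan.
move=> _ [J [L [+ ->]]]; rewrite leqn0 size_eq0 => /eqP ->.
by rewrite /preimage /monomial /= cmul1l; apply: sub_clspan; exists L.
Qed.

(** The heart of the proof: every fixed vector of u lies in the space K of
    every cyclic vector. *)
Lemma fixed_vector_in_K_space u (x : gns_space G) :
  cuntz_plus s u -> star u ** u = \1 -> p u x = x -> K x.
Proof.
move=> us uu ux.
have usx : p (star u) x = x by rewrite -{1}ux -repM uu rep1.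
have Kcl : closed K by have [] := @closed_subspace_clspan _ _ [set x |
  exists J : word n, x = p (star (wordprod s J)) v].
rewrite [K](closure_id _).1 //; apply/closure_normP => e e0.
have e20 : 0 < e / 2 by rewrite divr_gt0.
have : closure (range (fun a => p a v)) x by rewrite gns_cyclic.
move=> /closure_normP/(_ _ e20)[_ [a _ <-] xa].
have : clspan (monomials s) a by rewrite generated.
move=> /closure_normP/(_ _ e20)[m mM am].
have [k Fm] := lspan_monomials_filtration mM.
(* The k-th power of u^* removes every left word of m. *)
exists (p (iter k (cmul (star u)) m) v).
  by apply: K_space_filtration; exact: iter_star_plus_filtration.
have contract j y : `|x - iter j (p (star u)) y| <= `|x - y|.
  elim: j => //= j IH; rewrite -{1}usx -linearB.
  by apply: le_trans IH; exact: rep_coisometry.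
(* Applying u^* does not move away from its fixed point x. *)
rewrite rep_iter; apply: le_lt_trans (contract _ _) _.
rewrite -(subrK (p a v) x) -addrA (splitr e).
apply: le_lt_trans (ler_normD _ _) _; rewrite ltrD //.
by rewrite -repB; apply: le_lt_trans (gns_norm_le _ _) am.
Qed.

(** Since [s_J^* s_L^* = (s_L s_J)^*], p(s_J)^* maps generators of K to
    generators of K. *)
Lemma K_space_invariant J (x : gns_space G) : K x -> K (p (star (wordprod s J)) x).
Proof.
move: x; apply: clspan_min.
  apply: (closed_subspace_preimage (g := id)) (closed_subspace_clspan _).
  - exact: rep_continuous.
  - exact: linearD.
  - by move=> *; rewrite linearZ.
move=> _ [L ->]; apply: sub_clspan; exists (L ++ J).
by rewrite wordprod_cat starM repM.
Qed.

End FixedVector.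

Lemma cdim_le_fixed w w' u : cuntz_plus s u -> star u ** u = \1 -> w u = 1 ->
  state_equiv w' w -> (cdim s w <= cdim s w')%E.
Proof.
move=> us uu wu /state_equiv_vector [G [v [w'v vcyc]]].
(* A triple of w' on the same space and representation as G. *)
pose G' := GNS w'v vcyc.
rewrite (cdim_hdim G) (cdim_hdim G').
have KO : K_space s (G := G') (gns_vec G).
  apply: (@fixed_vector_in_K_space w' G' u) => //.
  by apply: rep_fixed => //; rewrite -(gns_state G) wu gns_vec_norm.
have [g gsurj] := word_enumeration.
have KK : K_space s (G := G) `<=` K_space s (G := G').
  apply: clspan_min; first exact: closed_subspace_clspan.
  by move=> _ [J ->]; exact: (@K_space_invariant w' G').
move: KK; rewrite /K_space !(adjoint_words_range (fun a => gns_rep _ a _) gsurj).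
move=> KK; apply: hdim_le => a; apply: sub_has_orthonormal => x xs.
by apply: KK; exact: subset_closure.
Qed.

Lemma minimal_of_plus_isometry w u :
  cuntz_plus s u -> star u ** u = \1 -> w u = 1 -> minimal s w.
Proof.
move=> us uu wu; rewrite /minimal /kappa.
have [[G]|noG] := pselect (inhabited (gns w)).
  apply/esym/xget_unique.
    split; first by exists w => //; exact: state_equiv_refl G.
    by move=> _ [w' w'w <-]; exact: (cdim_le_fixed us uu wu w'w).
  move=> _ [[w' w'w <-] lb]; apply/eqP; rewrite eq_le.
  rewrite (cdim_le_fixed us uu wu w'w) andbT; apply: lb.
  by exists w => //; exact: state_equiv_refl G.
(* Without any GNS triple, [cdim] and [kappa] both take the default value. *)
rewrite /cdim !xgetPN //.
- by move=> d [[w' [G' [G _]] _] _]; apply: noG; constructor.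
- by move=> d [G _]; apply: noG; constructor.
Qed.

End Minimality.

Theorem theorem1p6 (R : realType) (n : ngen) (hn : ge2 n)
    (A : cstarAlgType R) (s : letter n -> A) (hA : is_cuntz_algebra s)
    (w : @state R A)
    (hw : exists u : A, [/\ cuntz_plus s u, star u ** u = \1 & w u = 1]) :
  minimal s w.
Proof.
have [u [us uu wu]] := hw; have [[orth _] gen _] := hA.
apply: (minimal_of_plus_isometry orth _ us uu wu).
apply: gen; first exact: cstar_subalgebra_monomials.
exact: monomials_letter.
Qed.
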